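(* Let $m \ge 1$ be a natural number. Then the origin is an isochronous center of the planar system $$\dot x = -y, \qquad \dot y = x + x^{2m-1} y\,(x^2+y^2).$$
   Context: A singular point of a planar system is a center if some punctured neighborhood of it is filled with closed orbits (cycles) surrounding it. A center is isochronous if all cycles near it have the same period. *)

(* Defs.v *)
From HB Require Import structures.
From mathcomp Require Import all_boot all_order all_algebra.
From mathcomp Require Import all_classical all_reals all_analysis.
Set Implicit Arguments.
Unset Strict Implicit.
Unset Printing Implicit Defensive.
Import Order.TTheory GRing.Theory Num.Theory.
Import numFieldNormedType.Exports.
Local Open Scope classical_set_scope.
Local Open Scope ring_scope.

(* A planar system z' = F z is given by its vector field
   F : R * R -> R * R. *)

Definition is_solution (R : realType) (F : R * R -> R * R) (g : R -> R * R) :=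
  forall t : R, is_derive t 1 (fun s => (g s).1) (F (g t)).1 /\
                is_derive t 1 (fun s => (g s).2) (F (g t)).2.

(* No constant function has a minimal period. *)
Definition minimal_period (R : realType) (g : R -> R * R) (T : R) :=
  [/\ 0 < T,
      forall t, g (t + T) = g t
    & forall S, 0 < S -> S < T -> exists t, g (t + S) <> g t].

Definition cycle_of_period (R : realType) (F : R * R -> R * R)
    (C : set (R * R)) (T : R) :=
  exists g : R -> R * R,
    [/\ is_solution F g, minimal_period g T & C = range g].

Definition is_cycle (R : realType) (F : R * R -> R * R) (C : set (R * R)) :=
  exists T : R, cycle_of_period F C T.

(* [p] lies in the interior of the closed curve [C]: the component of the
   complement of [C] containing [p] is bounded. *)
Definition surrounds (R : realType) (C : set (R * R)) (p : R * R) :=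
  ~ C p /\ bounded_set (connected_component (~` C) p).

(* Requiring [C `<=` U `\ p] makes [U `\ p] exactly a union of cycles. *)
Definition center (R : realType) (F : R * R -> R * R) (p : R * R) :=
  F p = (0, 0) /\
  exists2 U : set (R * R), nbhs p U &
    forall q, (U `\ p) q ->
      exists C : set (R * R),
        [/\ is_cycle F C, C q, C `<=` U `\ p & surrounds C p].

(* The cycles near [p] are those passing through a small neighbourhood of [p];
   at a center every point of such a punctured neighbourhood is on a cycle, so
   the condition is not vacuous. *)
Definition isochronous_center (R : realType) (F : R * R -> R * R)
    (p : R * R) :=
  center F p /\
  exists (T : R) (V : set (R * R)), nbhs p V /\
    forall (C : set (R * R)) (S : R),
      cycle_of_period F C S -> C `&` V !=set0 -> S = T.

(* Main.v *)
Require Import Defs.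
From HB Require Import structures.
From mathcomp Require Import all_boot all_order all_algebra.
From mathcomp Require Import all_classical all_reals all_analysis.
From mathcomp Require Import ring lra.
Set Implicit Arguments.
Unset Strict Implicit.
Unset Printing Implicit Defensive.
Import Order.TTheory GRing.Theory Num.Theory.
Import numFieldNormedType.Exports.
Local Open Scope classical_set_scope.
Local Open Scope ring_scope.

(* In polar coordinates, d/dt (theta + x ^ n / n) = 1 along the flow, where
   n = 2 m + 1. Hence an orbit that winds once around the origin and closes up
   does so after time exactly 2 pi. As a function of xi = sin theta in [-1, 1],
   the quantity u = r ^ - n satisfies
     u' = - n (1 - xi ^ 2) ^ (m - 1) xi ^ 2 u / (u + (1 - xi ^ 2) ^ m xi),
   whose right-hand side is nearly constant in u for u large (r small), so that
   one Picard contraction gives a solution on all of [-1, 1]. The curve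
   r = u (sin theta) ^ (- 1 / n) is then closed by construction, and inverting
   theta + x ^ n / n as a function of theta parametrizes it as a solution. By
   uniqueness of solutions, every cycle near the origin is one of these. *)

(** * Derivatives and the Picard theorem *)

Section derivatives.
Context {R : realType}.
Implicit Types (f g : R -> R) (x a b c : R).

Lemma isd_cst c x : is_derive x 1 (fun _ : R => c) 0.
Proof. exact: is_derive_cst. Qed.

Lemma isd_add f g x a b :
  is_derive x 1 f a -> is_derive x 1 g b ->
  is_derive x 1 (fun s => f s + g s) (a + b).
Proof. by move=> fa gb; apply: is_deriveD. Qed.

Lemma isd_sub f g x a b :
  is_derive x 1 f a -> is_derive x 1 g b ->
  is_derive x 1 (fun s => f s - g s) (a - b).
Proof. by move=> fa gb; apply: is_deriveB. Qed.

Lemma isd_mul f g x a b :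
  is_derive x 1 f a -> is_derive x 1 g b ->
  is_derive x 1 (fun s => f s * g s) (f x * b + g x * a).
Proof. by move=> fa gb; apply: is_deriveM. Qed.

Lemma isd_comp f g x a b :
  is_derive (g x) 1 f a -> is_derive x 1 g b ->
  is_derive x 1 (fun s => f (g s)) (a * b).
Proof. by move=> fa gb; apply: is_derive1_comp. Qed.

Lemma isd_exp f n x a :
  is_derive x 1 f a ->
  is_derive x 1 (fun s => f s ^+ n) (n%:R * f x ^+ n.-1 * a).
Proof.
move=> fa; have -> : (fun s => f s ^+ n) = f ^+ n.
  by apply/funext => s; rewrite exprfctE.
exact: is_deriveX.
Qed.

Lemma isd_inv f x a :
  is_derive x 1 f a -> f x != 0 ->
  is_derive x 1 (fun s => (f s)^-1) (- (f x) ^- 2 * a).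
Proof. by move=> fa fx0; apply: (is_derive_eq (is_deriveV fx0 fa)). Qed.

Lemma is_derive_continuous f x a : is_derive x 1 f a -> {for x, continuous f}.
Proof. by case=> /derivable1_diffP /differentiable_continuous. Qed.

(** Mean value inequality. The derivative is taken on the open interval only, which is where
    [picard_step] provides it. *)
Lemma derive_bound f df (a b K : R) :
  {within `[a, b], continuous f} ->
  (forall z, a < z < b -> is_derive z 1 f (df z)) ->
  (forall z, a < z < b -> `|df z| <= K) ->
  {in `[a, b] &, forall x y, `|f x - f y| <= K * `|x - y|}.
Proof.
move=> cf fd dfK x y.
wlog xy : x y / x < y.
  move=> H xab yab; case: (ltgtP x y) => [xy|yx|->]; first exact: H.
    by rewrite distrC [`|x - y|]distrC; exact: H.
  by rewrite !subrr normr0 mulr0.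
rewrite !in_itv /= => /andP[ax xb] /andP[ay yb].
have sub z : z \in `]x, y[ -> a < z < b.
  rewrite in_itv /= => /andP[xz zy].
  by rewrite (le_lt_trans ax xz) (lt_le_trans zy yb).
rewrite distrC; have [||c cxy ->] := @MVT _ f df x y xy.
- by move=> z /sub; exact: fd.
- apply: continuous_subspaceW cf => z /=; rewrite !in_itv /= => /andP[xz zy].
  by rewrite (le_trans ax xz) (le_trans zy yb).
by rewrite normrM [`|x - y|]distrC ler_wpM2r ?normr_ge0 // dfK // sub.
Qed.

Lemma exists_antiderivative f (a b : R) :
  continuous f ->
  exists F : R -> R, forall x, a < x < b -> is_derive x 1 F (f x).
Proof.
move=> cf; exists (fun x => \int[lebesgue_measure]_(t in `[a, x]) f t).
move=> x /andP[ax xb].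
have [|||dF F'] := @continuous_FTC1_closed R f a x b xb.
- apply: continuous_compact_integrable; first exact: segment_compact.
  exact: continuous_subspaceT.
- exact: ax.
- exact: cf.
by apply: (DeriveDef dF); rewrite -derive1E; exact: F'.
Qed.

End derivatives.

(** * Picard iteration on a single interval *)

Section picard.
Context {R : realType}.
Variables (f : R -> R -> R) (a b x0 y0 L : R).
Hypothesis f_cont :
  forall phi : R -> R, continuous phi -> continuous (fun x => f x (phi x)).
Hypothesis f_lip : forall x y z, `|f x y - f x z| <= L * `|y - z|.
Hypothesis x0ab : a <= x0 <= b.
Hypothesis L_small : L * (b - a) <= 2^-1.

(** Precomposition with [clamp] extends a function from [a, b] by constants, so that continuity and
    uniform bounds make sense on the whole line. *)
Let clamp (x : R) := Num.max a (Num.min x b).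

Let clamp_itv x : a <= clamp x <= b.
Proof.
case/andP: x0ab => ax0 x0b; rewrite /clamp le_max lexx /= ge_max.
by rewrite (le_trans ax0 x0b) ge_min lexx orbT.
Qed.

Let clamp_id x : a <= x <= b -> clamp x = x.
Proof. by case/andP=> ax xb; rewrite /clamp min_l // max_r. Qed.

Let clamp_cont : continuous clamp.
Proof.
move=> x; apply: (@continuous_max R R (cst a) (fun y => Num.min y b)).
  exact: cst_continuous.
apply: (@continuous_min R R id (cst b)); last exact: cst_continuous.
exact: cvg_id.
Qed.

(* Picard's operator as a relation, on functions constant outside [a, b]. *)
Let picard_step (phi psi : R -> R) :=
  [/\ continuous psi, psi x0 = y0, forall x, psi x = psi (clamp x) &
      forall x, a < x < b -> is_derive x 1 psi (f x (phi x))].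

Let picard_stepP phi : continuous phi -> exists psi, picard_step phi psi.
Proof.
move=> cphi.
(* The margin of 1 on each side makes [F] differentiable, hence continuous, at [a] and [b] too. *)
have [F dF] := exists_antiderivative (a - 1) (b + 1) (f_cont cphi).
have dF' x : a <= x <= b -> is_derive x 1 F (f x (phi x)).
  case/andP=> ax xb; apply: dF; rewrite ltrBlDr (le_lt_trans ax) ?ltrDl //=.
  by rewrite (le_lt_trans xb) // ltrDl.
exists (fun x => y0 + (F (clamp x) - F x0)); split.
- move=> x; apply: (@continuousD _ _ _ (cst y0) (fun x => F (clamp x) - F x0)).
    exact: cst_continuous.
  apply: (@continuousB _ _ _ (fun x => F (clamp x)) (cst (F x0))).
    apply: continuous_comp; first exact: clamp_cont.
    exact: is_derive_continuous (dF' _ (clamp_itv x)).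
  exact: cst_continuous.
- by rewrite clamp_id // subrr addr0.
- by move=> x; rewrite (clamp_id (clamp_itv x)).
- move=> x /andP[ax xb].
  apply: (@near_eq_is_derive _ _ _ (fun x => y0 + (F x - F x0))).
    near=> z; rewrite clamp_id //; apply/andP; split; apply: ltW; near: z.
      exact: lt_nbhsr.
    exact: lt_nbhsl.
  apply: (is_derive_eq (isd_add (isd_cst y0 x) (isd_sub (dF' x _) (isd_cst _ x)))).
    by rewrite !ltW.
  by rewrite subr0 add0r.
Unshelve. all: by end_near. Qed.

(** The images agree at [x0] and their derivatives differ by at most [L * e]. By the mean value
    inequality they differ by at most [L * e * (b - a)], and [L_small] turns this into [e / 2]. *)
Let picard_contract phi1 phi2 psi1 psi2 e :
  picard_step phi1 psi1 -> picard_step phi2 psi2 ->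
  (forall x, `|phi1 x - phi2 x| <= e) ->
  forall x, `|psi1 x - psi2 x| <= e / 2.
Proof.
move=> [c1 i1 k1 d1] [c2 i2 k2 d2] he x.
have e0 : 0 <= e by apply: le_trans (he 0).
have L0 : 0 <= L.
  have := f_lip 0 1 0; rewrite subr0 normr1 mulr1; exact: le_trans.
rewrite k1 k2; have /andP[ac cb] := clamp_itv x; case/andP: x0ab => ax0 x0b.
have /(_ (clamp x) x0) : {in `[a, b] &, forall z t,
    `|psi1 z - psi2 z - (psi1 t - psi2 t)| <= L * e * `|z - t|}.
  apply: (derive_bound (df := fun x => f x (phi1 x) - f x (phi2 x))).
  - apply: continuous_subspaceT => z; apply: continuousB; [exact: c1|exact: c2].
  - by move=> z zab; apply: isd_sub; [exact: d1|exact: d2].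
  - by move=> z _; apply: le_trans (f_lip _ _ _) _; rewrite ler_wpM2l.
rewrite !in_itv /= ac cb ax0 x0b i1 i2 subrr subr0 => /(_ isT isT) /le_trans.
apply.
have : `|clamp x - x0| <= b - a by rewrite ler_norml; apply/andP; split; lra.
move=> /(ler_wpM2l (mulr_ge0 L0 e0)) /le_trans; apply.
by rewrite mulrAC mulrC ler_wpM2l.
Qed.

(** The iterates from the constant [y0] converge uniformly at the rate 2^-n, and their limit is a
    fixed point of the Picard operator. *)
Theorem picard_lindelof :
  exists phi : R -> R, [/\ continuous phi, phi x0 = y0 &
    forall x, a < x < b -> is_derive x 1 phi (f x (phi x))].
Proof.
(* Choice needs a total relation; a discontinuous [phi] gets itself as a dummy image. *)
have /choice[P hP] : forall phi : R -> R,
    exists psi, continuous phi -> picard_step phi psi.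
  move=> phi; have [c|nc] := pselect (continuous phi).
    by have [psi ?] := picard_stepP c; exists psi.
  by exists phi.
pose u n : R -> R := iter n P (cst y0).
have cu n : continuous (u n).
  elim: n => [|n IH] /=; first exact: cst_continuous.
  by case: (hP _ IH).
have su n : picard_step (u n) (u n.+1) := hP _ (cu n).
(* The first displacement attains its maximum on [a, b], and both iterates are constant outside. *)
have [D D0 hD] : exists2 D, 0 <= D & forall x, `|u 1%N x - u 0%N x| <= D.
  case: (su 0%N) => c1 _ k1 _.
  have ab : a <= b by case/andP: x0ab; exact: le_trans.
  have [|c cab hc] := @EVT_max R (fun x => `|u 1%N x - y0|) a b ab.
    apply: continuous_subspaceT => z.
    apply: (@continuous_comp _ _ _ (fun x => u 1%N x - y0) Num.norm).
      by apply: continuousB; [exact: c1|exact: cst_continuous].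
    exact: norm_continuous.
  exists (`|u 1%N c - y0|) => // x; rewrite k1; apply: hc.
  by rewrite in_itv /=; exact: clamp_itv.
have step n x : `|u n.+1 x - u n x| <= D / 2 ^+ n.
  elim: n x => [|n IH] x; first by rewrite expr0 divr1.
  apply: le_trans (picard_contract (su n.+1) (su n) IH x) _.
  by rewrite exprSr invfM mulrA.
(* The exact sum of the geometric steps, so that the induction on [k] closes. *)
have tail n k x : `|u (n + k)%N x - u n x| <= 2 * D / 2 ^+ n - 2 * D / 2 ^+ (n + k).
  elim: k => [|k IH]; first by rewrite addn0 !subrr normr0.
  rewrite addnS -[u _ x - _](subrKA (u (n + k)%N x)).
  apply: le_trans (ler_normD _ _) _.
  apply: le_trans (lerD (step _ _) IH) _.
  rewrite le_eqVlt; apply/orP; left; apply/eqP.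
  have h : (2 : R) ^+ (n + k) != 0 by rewrite expf_neq0.
  have h' : (2 : R) ^+ n != 0 by rewrite expf_neq0.
  by rewrite exprS; field; rewrite h h'.
have tail' n k x : `|u (n + k)%N x - u n x| <= 2 * D / 2 ^+ n.
  apply: le_trans (tail n k x) _; rewrite gerBl; apply: divr_ge0.
    exact: mulr_ge0.
  exact: exprn_ge0.
have small e : 0 < e -> exists n, 2 * D / 2 ^+ n < e.
  move=> e0; have := @cvg_geometric R (2 * D) 2^-1.
  rewrite ger0_norm ?invr_ge0 // invf_lt1 ?ltr1n // => /(_ isT).
  move=> /cvgrPdist_lt /(_ e e0) [N _ /(_ N (leqnn _))] /=.
  rewrite sub0r normrN exprVn ger0_norm; first by exists N.
  by apply: divr_ge0; [exact: mulr_ge0|exact: exprn_ge0].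
have ucvg x : cvg (u n x @[n --> \oo]).
  apply: cauchy_cvg; apply/cauchy_exP => e e0.
  have [N hN] := small e e0; exists (u N x); exists N => // n /= Nn.
  rewrite /ball /= distrC; apply: le_lt_trans hN.
  by rewrite -(subnKC Nn); exact: tail'.
pose phi x := lim (u n x @[n --> \oo]).
have hphi n x : `|phi x - u n x| <= 2 * D / 2 ^+ n.
  rewrite ler_distl; apply/andP; split.
    apply: limr_ge; first exact: ucvg.
    exists n => // k /= nk; have := tail' n (k - n)%N x; rewrite subnKC //.
    by rewrite ler_distl => /andP[].
  apply: limr_le; first exact: ucvg.
  exists n => // k /= nk; have := tail' n (k - n)%N x; rewrite subnKC //.
  by rewrite ler_distl => /andP[].
have cphi : continuous phi.
  move=> x; apply/cvgrPdist_lt => e e0.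
  have [|N hN] := small (e / 3); first by rewrite divr_gt0.
  have := cu N x; move/cvgrPdist_lt => /(_ (e / 3)); rewrite divr_gt0 // => /(_ isT).
  apply: filterS => z hz.
  have := hphi N x; have := hphi N z.
  rewrite [`|phi z - _|]distrC => h1 h2.
  have -> : phi x - phi z = (phi x - u N x) + (u N x - u N z) + (u N z - phi z) by ring.
  apply: le_lt_trans (ler_normD _ _) _.
  apply: le_lt_trans (lerD (ler_normD _ _) (lexx _)) _; lra.
have sphi := hP _ cphi.
(* Both [P phi] and [phi] are arbitrarily close to [u N.+1]: the first by contraction, the second by
   convergence. *)
have phiP : P phi = phi.
  apply/funext => x; apply/eqP; rewrite -subr_eq0 -normr_le0.
  apply/ler_addgt0Pr => e e0; rewrite add0r.
  have [|N hN] := small (e / 2); first by rewrite divr_gt0.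
  have h1 := picard_contract sphi (su N) (hphi N) x.
  have h2 := hphi N.+1 x.
  have -> : P phi x - phi x = (P phi x - u N.+1 x) - (phi x - u N.+1 x) by ring.
  apply: le_trans (ler_normB _ _) _.
  have h3 : 2 * D / 2 ^+ N.+1 = 2 * D / 2 ^+ N / 2.
    by rewrite exprSr invfM mulrA.
  rewrite h3 in h2; lra.
case: sphi; rewrite phiP => _ i _ d.
by exists phi; split.
Qed.

End picard.

Section pointwise_continuity.
Context {R : realType} {T : topologicalType}.
Implicit Types (f g : T -> R) (x : T).

Lemma cont_opp f x :
  {for x, continuous f} -> {for x, continuous (fun y => - f y)}.
Proof. by move=> cf; exact: continuousN. Qed.

Lemma cont_add f g x : {for x, continuous f} -> {for x, continuous g} ->
  {for x, continuous (fun y => f y + g y)}.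
Proof. by move=> cf cg; exact: continuousD. Qed.

Lemma cont_mul f g x : {for x, continuous f} -> {for x, continuous g} ->
  {for x, continuous (fun y => f y * g y)}.
Proof. by move=> cf cg; exact: continuousM. Qed.

Lemma cont_inv f x : {for x, continuous f} -> f x != 0 ->
  {for x, continuous (fun y => (f y)^-1)}.
Proof. by move=> cf f0; exact: continuousV. Qed.

Lemma cont_exp f n x :
  {for x, continuous f} -> {for x, continuous (fun y => f y ^+ n)}.
Proof.
by move=> cf; exact: (continuous_comp cf (@exprn_continuous R n (f x))).
Qed.

End pointwise_continuity.

(** * Closed orbits in polar coordinates *)

Section radial.
Context {R : realType}.

(** The difference is [p * q / ((u + q) * (v + q))] times [u - v], and both factors of the
    denominator are at least [8 * c + 1]. *)
Lemma radial_lipschitz (p q c u v : R) :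
  `|p| <= c -> `|q| <= 1 -> 8 * c + 2 <= u -> 8 * c + 2 <= v ->
  `|p * (u / (u + q)) - p * (v / (v + q))| <= 8^-1 * `|u - v|.
Proof.
move=> pc q1 uM vM.
have c0 : 0 <= c by apply: le_trans pc.
have /andP[q1' q2] : -1 <= q <= 1 by rewrite -ler_norml.
have u0 : 0 < u + q by lra.
have v0 : 0 < v + q by lra.
have -> : p * (u / (u + q)) - p * (v / (v + q)) =
    p * q / ((u + q) * (v + q)) * (u - v).
  by field; rewrite !gt_eqF.
rewrite normrM ler_wpM2r // !normrM normfV normrM.
rewrite (gtr0_norm u0) (gtr0_norm v0) ler_pdivrMr ?mulr_gt0 //.
have : `|p| * `|q| <= c * 1 by apply: ler_pM.
by nra.
Qed.

Lemma radial_bound (p q c u : R) :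
  `|p| <= c -> `|q| <= 1 -> 2 <= u -> `|p * (u / (u + q))| <= 2 * c.
Proof.
move=> pc q1 u2.
have /andP[q1' q2] : -1 <= q <= 1 by rewrite -ler_norml.
have uq : 0 < u + q by lra.
rewrite normrM mulrC ler_pM ?normr_ge0 // ger0_norm ?divr_ge0 ?ler_pdivrMr //; lra.
Qed.

(** The right-hand side is cut off below [M] to make it globally Lipschitz. Its size is at most
    [2 * c], so a solution starting at [16 * c + 2] or above loses at most [4 * c] on [-1, 1] and
    never meets the cutoff. *)
Lemma radial_ode (A B : R -> R) (c x0 u0 : R) :
  continuous A -> continuous B ->
  (forall x, `|A x| <= c) -> (forall x, `|B x| <= 1) ->
  -1 <= x0 <= 1 -> 16 * c + 2 <= u0 ->
  exists u : R -> R, [/\ continuous u, u x0 = u0,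
    (forall x : R, -1 <= x <= 1 -> 2 <= u x) &
    forall x : R, -1 <= x <= 1 ->
      is_derive x 1 u (- (A x * (u x / (u x + B x))))].
Proof.
move=> cA cB Ac B1 /andP[x0l x0r] u0M.
have c0 : 0 <= c by apply: le_trans (Ac 0).
pose M := 8 * c + 2.
pose f x y := - (A x * (Num.max M y / (Num.max M y + B x))).
have maxM y : M <= Num.max M y by rewrite le_max lexx.
have max2 y : 2 <= Num.max M y by apply: le_trans (maxM y); rewrite /M; lra.
have fbound x y : `|f x y| <= 2 * c.
  by rewrite /f normrN; exact: radial_bound.
have f_cont (phi : R -> R) : continuous phi -> continuous (fun x => f x (phi x)).
  move=> cphi x.
  have cmax : {for x, continuous (fun x => Num.max M (phi x))}.
    apply: (@continuous_max R R (cst M) phi); first exact: cst_continuous.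
    exact: cphi.
  have nz : Num.max M (phi x) + B x != 0.
    have /andP[? _] : -1 <= B x <= 1 by rewrite -ler_norml.
    by have ? := max2 (phi x); rewrite gt_eqF //; lra.
  exact: (cont_opp (cont_mul (cA x)
    (cont_mul cmax (cont_inv (cont_add cmax (cB x)) nz)))).
have f_lip x y z : `|f x y - f x z| <= 8^-1 * `|y - z|.
  rewrite /f -opprD normrN.
  apply: le_trans (radial_lipschitz (Ac x) (B1 x) (maxM y) (maxM z)) _.
  rewrite ler_pM2l ?invr_gt0 //.
  (* Truncation from below is 1-Lipschitz. *)
  rewrite /Num.max; case: ltP => h1; case: ltP => h2.
  - by [].
  - by rewrite !ger0_norm; lra.
  - by rewrite distrC [`|y - z|]distrC !ger0_norm; lra.
  - by rewrite subrr normr0.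
(* On [-2, 2] the product of Lipschitz constant and length is exactly 1/2, and the points -1 and 1
   are interior, hence have two-sided derivatives. *)
have [||u [cu ux0 du]] :=
    @picard_lindelof R f (-2) 2 x0 u0 8^-1 f_cont f_lip.
- by apply/andP; split; lra.
- lra.
have uM x : -1 <= x <= 1 -> M <= u x.
  case/andP=> xl xr.
  have /(_ x0 x) : {in `[(-2), 2] &, forall z t,
      `|u z - u t| <= 2 * c * `|z - t|}.
    apply: (derive_bound (df := fun x => f x (u x))) => //.
    exact: continuous_subspaceT.
  rewrite !in_itv /= ux0.
  have -> : -2 <= x0 <= 2 by apply/andP; split; lra.
  have -> : -2 <= x <= 2 by apply/andP; split; lra.
  move=> /(_ isT isT) h.
  have hx : `|x0 - x| <= 2 by rewrite ler_norml; apply/andP; split; lra.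
  have := ler_norm (u0 - u x); rewrite /M.
  by nra.
exists u; split => // x xb.
  by apply: le_trans (uM x xb); rewrite /M; lra.
have := du x; case/andP: (xb) => xl xr; rewrite /f max_r ?uM //; apply.
by apply/andP; split; lra.
Qed.

(* Here [k] stands for [m - 1], so that [n = 2 k + 3]; the orbits satisfy
   [u' = - a u / (u + b)]. *)
Definition radial_a k (xi : R) := (2 * k + 3)%:R * ((1 - xi ^+ 2) ^+ k * xi ^+ 2).
Definition radial_b k (xi : R) := (1 - xi ^+ 2) ^+ k.+1 * xi.

Lemma expr_itv01 n (x : R) : 0 <= x <= 1 -> 0 <= x ^+ n <= 1.
Proof. by case/andP=> x0 x1; rewrite exprn_ge0 //= exprn_ile1. Qed.

Lemma radial_a_bound k xi : -1 <= xi <= 1 -> `|radial_a k xi| <= (2 * k + 3)%:R.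
Proof.
case/andP=> x0 x1.
have h : 0 <= 1 - xi ^+ 2 <= 1 by apply/andP; split; nra.
have /andP[h0 h1] := expr_itv01 k h; case/andP: h => h2 h3.
have h4 : 0 <= (1 - xi ^+ 2) ^+ k * xi ^+ 2 by rewrite mulr_ge0 // sqr_ge0.
rewrite normrM ger0_norm // ger0_norm // ler_piMr // mulr_ile1 // ?sqr_ge0 //; nra.
Qed.

Lemma radial_b_bound k xi : -1 <= xi <= 1 -> `|radial_b k xi| <= 1.
Proof.
case/andP=> x0 x1.
have h : 0 <= 1 - xi ^+ 2 <= 1 by apply/andP; split; nra.
have /andP[h0 h1] := expr_itv01 k.+1 h.
rewrite normrM mulr_ile1 // ?(ger0_norm h0) // ler_norml.
by apply/andP; split; lra.
Qed.

(** The bounds on the coefficients hold only on [-1, 1], so [radial_ode] is applied to the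
    coefficients composed with a clamp, which is the identity there. *)
Lemma radial_solution k (x0 u0 : R) :
  -1 <= x0 <= 1 -> 16 * (2 * k + 3)%:R + 2 <= u0 ->
  exists u : R -> R, [/\ continuous u, u x0 = u0,
    (forall x : R, -1 <= x <= 1 -> 2 <= u x) &
    forall x : R, -1 <= x <= 1 ->
      is_derive x 1 u (- (radial_a k x * (u x / (u x + radial_b k x))))].
Proof.
move=> x0b u0M.
pose clamp (x : R) := Num.max (-1) (Num.min x 1).
have clampb x : -1 <= clamp x <= 1.
  by rewrite /clamp le_max lexx /= ge_max ge_min lexx orbT andbT; lra.
have clampE x : -1 <= x <= 1 -> clamp x = x.
  by case/andP=> ? ?; rewrite /clamp min_l // max_r.
have cclamp : continuous clamp.
  move=> x; apply: (@continuous_max R R (cst (-1)) (fun y => Num.min y 1)).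
    exact: cst_continuous.
  by apply: (@continuous_min R R id (cst 1)); [exact: cvg_id|exact: cst_continuous].
have ca : continuous (radial_a k).
  move=> x; pose d := is_derive_id x (1 : R).
  have dq := isd_sub (isd_cst 1 x) (isd_exp 2 d).
  exact: is_derive_continuous
    (isd_mul (isd_cst _ x) (isd_mul (isd_exp k dq) (isd_exp 2 d))).
have cb : continuous (radial_b k).
  move=> x; pose d := is_derive_id x (1 : R).
  have dq := isd_sub (isd_cst 1 x) (isd_exp 2 d).
  exact: is_derive_continuous (isd_mul (isd_exp k.+1 dq) d).
have [||||u [cu ux0 u2 du]] := @radial_ode (radial_a k \o clamp)
    (radial_b k \o clamp) (2 * k + 3)%:R x0 u0 _ _ _ _ x0b u0M.
- by move=> x; apply: continuous_comp; [exact: cclamp|exact: ca].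
- by move=> x; apply: continuous_comp; [exact: cclamp|exact: cb].
- by move=> x; exact: radial_a_bound.
- by move=> x; exact: radial_b_bound.
exists u; split => // x xb.
by have := du x xb; rewrite /= clampE.
Qed.

End radial.

(** * Inverting the time function *)

Section time_change.
Context {R : realType}.

(** [T] is strictly increasing, and [T (t - 1) <= t <= T (t + 1)] makes it onto by the intermediate
    value theorem; the inverse function rule gives the derivative. *)
Lemma inverse_time (T dT : R -> R) :
  (forall x : R, is_derive x 1 T (dT x)) -> (forall x : R, 0 < dT x) ->
  (forall x : R, `|T x - x| <= 1) ->
  exists th : R -> R, [/\ {homo T : x y / x < y}, cancel T th, cancel th T &
    forall t : R, is_derive t 1 th (dT (th t))^-1].
Proof.
move=> dTE dT0 T1.
have cT : continuous T by move=> x; exact: is_derive_continuous (dTE x).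
have Tlt : {homo T : x y / x < y}.
  move=> x y xy; rewrite -subr_gt0.
  have cTxy := @continuous_subspaceT _ _ `[x, y] T cT.
  have [c _ ->] := MVT xy (fun z _ => dTE z) cTxy.
  by rewrite mulr_gt0 // subr_gt0.
have Tinj : injective T.
  move=> x y Txy; case: (ltgtP x y) => // /Tlt; by rewrite Txy ltxx.
have /choice[th thK] : forall t, exists x, T x = t.
  move=> t.
  have h1 := T1 (t - 1); have h2 := T1 (t + 1).
  rewrite !ler_norml in h1 h2; case/andP: h1 => h1 h1'; case/andP: h2 => h2 h2'.
  have [|||x _ <-] := @IVT R T (t - 1) (t + 1) t; [by lra| | |by exists x].
    exact: continuous_subspaceT.
  have h3 : T (t - 1) <= t by lra.
  have h4 : t <= T (t + 1) by lra.
  by rewrite ge_min le_max h3 h4 orbT.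
have Tth : cancel T th by move=> x; apply: Tinj; rewrite thK.
exists th; split => // t; rewrite -{1}(thK t).
have dn0 : dT (th t) != 0 by rewrite gt_eqF.
have nK : {near th t, cancel T th} by near=> z; exact: Tth.
have nT : {near th t, continuous T} by near=> z; exact: cT.
exact: (is_derive_inverse nK nT (dTE (th t)) dn0).
Unshelve. all: by end_near. Qed.

(** By the half-angle formula, [1 - cos d] is twice the square of [sin (d / 2)], which is
    positive. *)
Lemma cos_eq1_itv (d : R) : 0 < d < pi *+ 2 -> cos d <> 1.
Proof.
case/andP=> d0 d1 cd.
have : 0 < sin (d / 2).
  by apply: sin_gt0_pi; rewrite divr_gt0 //= ltr_pdivrMr // mulr_natr.
have d2 : d / 2 *+ 2 = d by rewrite -mulr_natr divfK.
have := cos_mulr2n (d / 2); rewrite d2 cd cos2sin2 mulr2n => h s0.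
have : sin (d / 2) ^+ 2 = 0 by lra.
by move/eqP; rewrite expf_eq0 /= gt_eqF.
Qed.

End time_change.

(** * The periodic solution carried by a radial solution *)

Section orbit.
Context {R : realType}.
Variables (k : nat) (u : R -> R).
Hypothesis u_ge2 : forall x : R, -1 <= x <= 1 -> 2 <= u x.
Hypothesis du : forall x : R, -1 <= x <= 1 ->
  is_derive x 1 u (- (radial_a k x * (u x / (u x + radial_b k x)))).

Let n : R := (2 * k + 3)%:R.

(** The real power u^(-1/n), in a form that is visibly positive and that the chain rule can
    differentiate. *)
Definition orbit_radius (theta : R) := expR (- ln (u (sin theta)) / n).

Definition orbit_point (theta : R) : R * R :=
  (orbit_radius theta * cos theta, orbit_radius theta * sin theta).

(* This is [theta + x ^ n / n], since [r ^ n = 1 / u]. *)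
Definition orbit_time (theta : R) :=
  theta + cos theta ^+ (2 * k + 3) * (n * u (sin theta))^-1.

Let sin_itv (theta : R) : -1 <= sin theta <= 1.
Proof. by rewrite sin_geN1 sin_le1. Qed.

Let n_gt0 : 0 < n. Proof. by rewrite ltr0n addn3. Qed.

Let U_gt0 theta : 0 < u (sin theta).
Proof. by have := u_ge2 (sin_itv theta); lra. Qed.

Let UB_gt0 theta : 0 < u (sin theta) + radial_b k (sin theta).
Proof.
have := radial_b_bound k (sin_itv theta); rewrite ler_norml => /andP[? _].
have := u_ge2 (sin_itv theta); lra.
Qed.

Let radial_b_sin (theta : R) :
  radial_b k (sin theta) = (cos theta ^+ k) ^+ 2 * cos theta ^+ 2 * sin theta.
Proof. by rewrite /radial_b -cos2sin2 exprSr exprAC. Qed.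

Let radial_a_sin (theta : R) :
  radial_a k (sin theta) = n * ((cos theta ^+ k) ^+ 2 * sin theta ^+ 2).
Proof. by rewrite /radial_a -cos2sin2 exprAC. Qed.

Lemma orbit_radiusX theta :
  orbit_radius theta ^+ (2 * k + 3) = (u (sin theta))^-1.
Proof.
rewrite /orbit_radius -expRM_natl mulrC divfK ?gt_eqF //.
by rewrite expRN lnK // posrE.
Qed.

(** The value is the reciprocal of the angular speed 1 + x^(2m) y = 1 + b/u of the system, where b
    is [radial_b]; hence [orbit_time] is time along the orbit. *)
Lemma is_derive_orbit_time (theta : R) :
  is_derive theta 1 orbit_time
    (u (sin theta) / (u (sin theta) + radial_b k (sin theta))).
Proof.
have dU := isd_comp (du (sin_itv theta)) (is_derive_sin theta).
have nU0 : n * u (sin theta) != 0 by rewrite mulf_neq0 // gt_eqF.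
have dV := isd_inv (isd_mul (isd_cst n theta) dU) nU0.
have dX := isd_exp (2 * k + 3) (is_derive_cos theta).
apply: (is_derive_eq (isd_add (is_derive_id theta 1) (isd_mul dX dV))).
have := UB_gt0 theta; have := U_gt0 theta.
rewrite radial_b_sin radial_a_sin -/n addn3 /= mulr0 addr0.
have cX : cos theta ^+ (2 * k).+2 = (cos theta ^+ k) ^+ 2 * cos theta ^+ 2.
  by rewrite -addn2 exprD mulnC exprM.
rewrite [_ ^+ (2 * k).+3]exprS cX.
set c := cos theta; set s := sin theta; set p := c ^+ k.
set v := u s => v0 vb0.
by field; rewrite exprMn -natrM -natrD !gt_eqF.
Qed.

(** This is dr/dtheta for the system: r' = r x^(2m-1) y^2 divided by the angular speed 1 + x^(2m) y,
    with r^n = 1/u. *)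
Lemma is_derive_orbit_radius (theta : R) :
  is_derive theta 1 orbit_radius
    (orbit_radius theta * ((cos theta ^+ k) ^+ 2 * sin theta ^+ 2 * cos theta /
      (u (sin theta) + radial_b k (sin theta)))).
Proof.
have dU := isd_comp (du (sin_itv theta)) (is_derive_sin theta).
have dL := isd_comp (is_derive1_ln (U_gt0 theta)) dU.
have dM := isd_mul (isd_sub (isd_cst 0 theta) dL) (isd_cst n^-1 theta).
have dE := isd_comp (is_derive_expR _) dM.
have -> : orbit_radius = fun s => expR ((0 - ln (u (sin s))) * n^-1).
  by apply/funext => s; rewrite /orbit_radius sub0r.
apply: (is_derive_eq dE); congr (_ * _).
have := UB_gt0 theta; have := U_gt0 theta.
rewrite radial_b_sin radial_a_sin.
set c := cos theta; set s := sin theta; set p := c ^+ k.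
set v := u s => v0 vb0.
by field; rewrite exprMn -natrM -natrD !gt_eqF.
Qed.

Definition system (m : nat) : R * R -> R * R :=
  fun z => let: (x, y) := z in
    (- y, x + x ^+ (2 * m - 1) * y * (x ^+ 2 + y ^+ 2)).

(** Equal points have equal radii, hence equal cosines and sines, so the cosine of the difference of
    the angles is 1. *)
Lemma orbit_point_inj theta1 theta2 :
  theta1 < theta2 < theta1 + pi *+ 2 -> orbit_point theta1 <> orbit_point theta2.
Proof.
move=> /andP[lt1 lt2] [].
have r1 : 0 < orbit_radius theta1 by exact: expR_gt0.
have r2 : 0 < orbit_radius theta2 by exact: expR_gt0.
move=> ec es.
have er : orbit_radius theta1 = orbit_radius theta2.
  have : orbit_radius theta1 ^+ 2 = orbit_radius theta2 ^+ 2.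
    rewrite -[LHS]mulr1 -[RHS]mulr1 -{1}(cos2Dsin2 theta1) -(cos2Dsin2 theta2).
    by rewrite !mulrDr -!exprMn ec es.
  by move/eqP; rewrite eqrXn2 ?ltW // => /eqP.
move: ec es; rewrite er => /mulfI ec /mulfI es.
apply: (@cos_eq1_itv R (theta2 - theta1)).
  by rewrite subr_gt0 lt1 /= ltrBlDl.
by rewrite cosB ec ?es ?gt_eqF // -!expr2 cos2Dsin2.
Qed.

Lemma orbit_solution :
  exists g : R -> R * R, [/\ is_solution (system k.+1) g,
    minimal_period g (pi *+ 2) & range g = range orbit_point].
Proof.
have [|||th [Tlt Tth thT dth]] := @inverse_time R orbit_time
    (fun theta => u (sin theta) / (u (sin theta) + radial_b k (sin theta))).
- exact: is_derive_orbit_time.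
- by move=> theta; rewrite divr_gt0.
(* The correction is a power of the cosine over [n * u], with [n >= 1] and [u >= 2]. *)
- move=> theta; rewrite /orbit_time addrAC subrr add0r.
  rewrite normrM normrX mulr_ile1 ?exprn_ge0 ?exprn_ile1 ?cos_max //.
  rewrite normfV invf_le1 ?normr_gt0 ?mulf_neq0 ?gt_eqF //.
  rewrite ger0_norm ?mulr_ge0 ?ltW //.
  have := u_ge2 (sin_itv theta).
  have : 1 <= n by rewrite ler1n addn3.
  by nra.
have thlt : {homo th : x y / x < y}.
  move=> x y xy; case: (ltgtP (th x) (th y)) => // [|e].
    by move/Tlt; rewrite !thT => /lt_trans /(_ xy); rewrite ltxx.
  by move: xy; rewrite -(thT x) e thT ltxx.
(* [orbit_time] differs from the identity by a 2 pi-periodic term, so it commutes with translation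
   by 2 pi, and so does its inverse. *)
have th_period t : th (t + pi *+ 2) = th t + pi *+ 2.
  rewrite -(Tth (th t + pi *+ 2)); congr th.
  by rewrite /orbit_time sinD2pi cosD2pi addrAC -{1}(thT t).
exists (orbit_point \o th); split.
- move=> t.
  have rX := orbit_radiusX (th t).
  have dr := isd_comp (is_derive_orbit_radius (th t)) (dth t).
  have dc := isd_comp (is_derive_cos (th t)) (dth t).
  have ds := isd_comp (is_derive_sin (th t)) (dth t).
  have := UB_gt0 (th t); have := U_gt0 (th t).
  move=> v0 vb0; split.
    apply: (is_derive_eq (isd_mul dr dc)) => /=.
    move: v0 vb0; rewrite radial_b_sin.
    set c := cos (th t); set s := sin (th t); set p := c ^+ k.
    set v := u s; set r := orbit_radius (th t) => v0 vb0.
    by field; rewrite !exprMn !gt_eqF.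
  apply: (is_derive_eq (isd_mul dr ds)) => /=.
  have -> : (2 * k.+1 - 1 = 2 * k + 1)%N by rewrite mulnS addnC -addnBA.
  have xX (r c : R) : (r * c) ^+ (2 * k + 1) = (r ^+ k) ^+ 2 * r * ((c ^+ k) ^+ 2 * c).
    by rewrite addn1 exprS mulnC exprM !exprMn; ring.
  rewrite xX; move: v0 vb0 rX; rewrite radial_b_sin [_ ^+ (2 * k + 3)]exprD mulnC exprM.
  set c := cos (th t); set s := sin (th t); set p := c ^+ k.
  set v := u s; set r := orbit_radius (th t); set q := r ^+ k => v0 vb0 rX.
  (* Collects the factor r^n, which [rX] replaces by 1/u. *)
  have -> : q ^+ 2 * r * (p ^+ 2 * c) * (r * s) * ((r * c) ^+ 2 + (r * s) ^+ 2)
     = (q ^+ 2 * r ^+ 3) * r * (p ^+ 2 * c * s) * (c ^+ 2 + s ^+ 2) by ring.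
  by rewrite rX; field; rewrite !exprMn !gt_eqF.
- split.
  + by rewrite mulrn_wgt0 // pi_gt0.
  + move=> t; rewrite /= th_period /orbit_point /orbit_radius.
    by rewrite sinD2pi cosD2pi.
  (* For 0 < S < 2 pi the angle [th S] lies strictly between [th 0] and [th 0 + pi *+ 2]. *)
  + move=> S S0 S1; exists 0 => /= /esym; apply: orbit_point_inj.
    by rewrite thlt ?add0r //= -th_period thlt // add0r.
- apply/seteqP; split => z [t _ <-] /=; first by exists (th t).
  by exists (orbit_time t) => //=; rewrite Tth.
Qed.

End orbit.

(** * The orbits surround the origin *)

Section surrounding.
Context {R : realType}.

(** The Euclidean norm, since the norm on the product type is the maximum norm. *)
Definition enorm (z : R * R) : R := Num.sqrt (z.1 ^+ 2 + z.2 ^+ 2).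

Lemma enorm_ge0 z : 0 <= enorm z. Proof. exact: sqrtr_ge0. Qed.

Lemma enormX2 z : enorm z ^+ 2 = z.1 ^+ 2 + z.2 ^+ 2.
Proof. by rewrite sqr_sqrtr // addr_ge0 // sqr_ge0. Qed.

Lemma enorm_eq0 z : enorm z = 0 -> z = (0, 0).
Proof.
case: z => x y h; have := enormX2 (x, y); rewrite h expr0n /= => /esym /eqP.
by rewrite paddr_eq0 ?sqr_ge0 // !sqrf_eq0 => /andP[/eqP-> /eqP->].
Qed.

Lemma enorm0 : enorm (0, 0) = 0.
Proof. by rewrite /enorm /= expr0n /= addr0 sqrtr0. Qed.

Lemma cont_fst (z : R * R) : {for z, continuous (fun w : R * R => w.1)}.
Proof. exact: cvg_fst. Qed.

Lemma cont_snd (z : R * R) : {for z, continuous (fun w : R * R => w.2)}.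
Proof. exact: cvg_snd. Qed.

Lemma continuous_enorm : continuous enorm.
Proof.
move=> z; have c := cont_add (cont_exp (n := 2) (@cont_fst z))
  (cont_exp (n := 2) (@cont_snd z)).
exact: (continuous_comp c (@sqrt_continuous R _)).
Qed.

(** Away from the origin the angle is the arc cosine of x/r, with the sign of y. *)
Lemma polar_form (z : R * R) : exists theta,
  z = (enorm z * cos theta, enorm z * sin theta).
Proof.
have [/enorm_eq0 ->|/eqP r0] := pselect (enorm z = 0).
  by exists 0; rewrite enorm0 !mul0r.
case: z r0 => x y; set r := enorm (x, y) => r0.
have rp : 0 < r by rewrite lt_neqAle eq_sym r0 enorm_ge0.
have rX : r ^+ 2 = x ^+ 2 + y ^+ 2 := enormX2 (x, y).
have xr : -1 <= x / r <= 1.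
  rewrite -ler_norml normrM normfV (gtr0_norm rp) ler_pdivrMr // mul1r.
  rewrite -(ler_pXn2r (n := 2)) ?nnegrE ?normr_ge0 ?(ltW rp) // real_normK ?num_real //.
  by rewrite rX lerDl sqr_ge0.
have sx : Num.sqrt (1 - (x / r) ^+ 2) = `|y| / r.
  rewrite -[RHS]ger0_norm ?divr_ge0 ?normr_ge0 ?ltW // -sqrtr_sqr.
  congr Num.sqrt; rewrite !exprMn real_normK ?num_real // exprVn.
  have -> : y ^+ 2 = r ^+ 2 - x ^+ 2 by rewrite rX addrAC subrr add0r.
  by field.
have cx : cos (acos (x / r)) = x / r by rewrite acosK // in_itv.
case: (leP 0 y) => y0.
  exists (acos (x / r)); rewrite cx sin_acos // sx ger0_norm //.
  by rewrite (mulrC r) divfK // (mulrC r) divfK.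
exists (- acos (x / r)); rewrite cosN sinN cx sin_acos // sx ltr0_norm //.
by rewrite mulNr opprK (mulrC r) divfK // (mulrC r) divfK.
Qed.

Variables (k : nat) (u : R -> R).
Hypothesis u_cont : continuous u.
Hypothesis u_ge2 : forall x : R, -1 <= x <= 1 -> 2 <= u x.

Let enorm_polar r theta : 0 <= r -> enorm (r * cos theta, r * sin theta) = r.
Proof.
move=> r0; rewrite /enorm /= !exprMn -mulrDr cos2Dsin2 mulr1 sqrtr_sqr.
exact: ger0_norm.
Qed.

(** Prescribing [u] at [sin theta] thus makes the orbit pass through a chosen point. *)
Lemma orbit_radiusE theta r :
  0 < r -> u (sin theta) = r ^- (2 * k + 3) -> orbit_radius k u theta = r.
Proof.
move=> r0 ur; rewrite /orbit_radius ur lnV ?posrE ?exprn_gt0 // opprK.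
by rewrite lnXn // -[ln r *+ _]mulr_natr mulfK ?lnK // pnatr_eq0 addn3.
Qed.

(* Negative inside the orbit, zero exactly on it; at the origin [z.2 / 0 = 0]
   and the value is -1. *)
Let level (z : R * R) := u (z.2 / enorm z) * enorm z ^+ (2 * k + 3) - 1.

Let slope_itv z : -1 <= z.2 / enorm z <= 1.
Proof.
have [theta zE] := polar_form z.
have -> : z.2 = enorm z * sin theta by rewrite {1}zE.
have [->|r0] := eqVneq (enorm z) 0; first by rewrite invr0 mulr0; lra.
by rewrite mulrAC divff // mul1r sin_geN1 sin_le1.
Qed.

Let level0 : level (0, 0) = -1.
Proof. by rewrite /level enorm0 addn3 expr0n /= mulr0 sub0r. Qed.

Let level_eq0 z : level z = 0 -> range (orbit_point k u) z.
Proof.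
move=> /eqP; rewrite subr_eq0 => /eqP h.
have r0 : 0 < enorm z.
  rewrite lt_neqAle enorm_ge0 andbT; apply/eqP => e.
  by move: h; rewrite -e addn3 expr0n /= mulr0 => /esym /eqP; rewrite oner_eq0.
have [theta zE] := polar_form z; exists theta => //; rewrite [RHS]zE.
rewrite /orbit_point (@orbit_radiusE theta (enorm z)) //.
have <- : z.2 / enorm z = sin theta.
  by rewrite {1}zE /= mulrAC divff ?mul1r // gt_eqF.
by rewrite -[LHS](mulfK (x := enorm z ^+ (2 * k + 3))) ?h ?mul1r // expf_neq0 // gt_eqF.
Qed.

Let level_cont : continuous level.
Proof.
move=> z.
have cN : {for z, continuous (fun w => enorm w ^+ (2 * k + 3))}.
  exact: (cont_exp (@continuous_enorm z)).
have [z0|r0] := eqVneq (enorm z) 0; last first.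
  have c := cont_mul (@cont_snd z) (cont_inv (@continuous_enorm z) r0).
  have cu := continuous_comp c (@u_cont _).
  exact: (cont_add (cont_mul cu cN) (@cst_continuous _ _ (-1 : R) z)).
(* At the origin the slope has no limit, but [u] is bounded by [u c] on [-1, 1] while the power of
   [enorm] tends to 0. *)
have [||c _ hc] := @EVT_max R u (-1) 1; first by lra.
  exact: continuous_subspaceT.
have c0 : 0 < u c.
  have h0 : 0 \in `[(-1), (1 : R)] by rewrite in_itv /=; apply/andP; split; lra.
  have := hc 0 h0; have := u_ge2 (x := 0); lra.
move/enorm_eq0 : z0 cN => -> cN; apply/cvgrPdist_lt => e e0.
rewrite level0; move/cvgrPdist_lt : cN => /(_ (e / u c)).
rewrite divr_gt0 // => /(_ isT); apply: filterS => w.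
rewrite enorm0 addn3 expr0n /= sub0r normrN ltr_pdivlMr // => h.
rewrite /level addn3 opprB addKr normrN.
apply: le_lt_trans h; rewrite normrM mulrC ler_wpM2l //.
have wi := slope_itv w.
rewrite ger0_norm; last by have := u_ge2 wi; lra.
by apply: hc; rewrite in_itv.
Qed.

(** The image under [level] of the component of the origin is an interval containing -1 and missing
    0, so [level] is negative on the component. As [u >= 2], this confines the component to the unit
    disc. *)
Lemma orbit_surrounds : surrounds (range (orbit_point k u)) (0, 0).
Proof.
set C := range _.
have C0 : ~ C (0, 0).
  move=> [theta _] /(congr1 enorm).
  rewrite enorm0 enorm_polar; last exact/ltW/expR_gt0.
  by apply/eqP; rewrite gt_eqF // expR_gt0.
split => //; set K := connected_component _ _.
have K0 : K (0, 0) by exact: connected_component_refl.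
have KC : K `<=` ~` C by exact: connected_component_sub.
have K_int : is_interval (level @` K).
  apply/connected_intervalP/connected_continuous_connected.
    exact: component_connected.
  exact: continuous_subspaceT.
have level_lt0 z : K z -> level z < 0.
  move=> Kz; rewrite ltNge; apply/negP => lz.
  have i0 : (level @` K) (-1) by exists (0, 0).
  have i1 : (level @` K) (level z) by exists z.
  have [|w Kw w0] := K_int _ _ i0 i1 0; first by rewrite lz andbT; lra.
  by apply: (KC w Kw); exact: level_eq0.
exists 1; split=> // M M1 z /level_lt0; rewrite /level subr_lt0 => h.
apply: le_trans (ltW M1).
have r1 : enorm z <= 1.
  rewrite leNgt; apply/negP => r1.
  have := exprn_ege1 (2 * k + 3) (ltW r1); have := u_ge2 (slope_itv z); nra.
have := enormX2 z; have := enorm_ge0 z => r0 rX.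
have h1 : z.1 ^+ 2 <= 1 by have := sqr_ge0 z.2; nra.
have h2 : z.2 ^+ 2 <= 1 by have := sqr_ge0 z.1; nra.
rewrite prod_normE /= ge_max !ler_norml.
by apply/andP; split; apply/andP; split; nra.
Qed.

End surrounding.

(** * Uniqueness of solutions *)

Section uniqueness.
Context {R : realType}.

(** On [a, b] the product of D with exp(-L t) does not increase and the product with exp(L t) does
    not decrease; the first settles [t > t0], the second [t < t0]. *)
Lemma gronwall_zero (D dD : R -> R) (a b t0 L : R) :
  (forall t : R, is_derive t 1 D (dD t)) -> (forall t : R, 0 <= D t) ->
  (forall t : R, a <= t <= b -> `|dD t| <= L * D t) ->
  a <= t0 <= b -> D t0 = 0 -> forall t : R, a <= t <= b -> D t = 0.
Proof.
move=> dDE D0 dDL /andP[at0 t0b] Dt0 t /andP[at_ tb].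
have dE (c s : R) : is_derive s 1 (fun s => D s * expR (c * s))
    ((dD s + c * D s) * expR (c * s)).
  have h := isd_comp (is_derive_expR (c * s))
    (isd_mul (isd_cst c s) (is_derive_id s 1)).
  apply: (is_derive_eq (isd_mul (dDE s) h)); ring.
have cE (c x y : R) : {within `[x, y], continuous (fun s : R => D s * expR (c * s))}.
  by apply: continuous_subspaceT => s; exact: is_derive_continuous (dE c s).
suff h : exists c, D t * expR (c * t) <= 0.
  case: h => c h; apply/eqP; rewrite eq_le D0 andbT.
  by rewrite -(pmulr_lle0 _ (expR_gt0 (c * t))).
have [t0t|tt0|<-] := ltgtP t0 t; last by exists 0; rewrite Dt0 mul0r.
- exists (- L); have [s st] := MVT t0t (fun s _ => dE (- L) s) (cE _ _ _).
  rewrite Dt0 mul0r subr0 => ->; move: st; rewrite in_itv /= => /andP[s1 s2].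
  have /dDL : a <= s <= b by apply/andP; split; lra.
  rewrite ler_norml => /andP[_ h]; rewrite pmulr_lle0 ?subr_gt0 //.
  by rewrite pmulr_lle0 ?expR_gt0 //; lra.
- exists L; have [s st] := MVT tt0 (fun s _ => dE L s) (cE _ _ _).
  rewrite Dt0 mul0r sub0r => hE; move: st; rewrite in_itv /= => /andP[s1 s2].
  have /dDL : a <= s <= b by apply/andP; split; lra.
  rewrite ler_norml => /andP[h _].
  rewrite -oppr_ge0 hE mulr_ge0 ?mulr_ge0 ?expR_ge0 ?subr_ge0 ?(ltW tt0) //; lra.
Qed.

(** A local Lipschitz condition that is stable under products, so that polynomials satisfy it. *)
Definition box_lipschitz (f : R * R -> R) := forall M : R,
  exists2 L, 0 <= L & forall z w : R * R,
    `|z.1| <= M -> `|z.2| <= M -> `|w.1| <= M -> `|w.2| <= M ->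
    `|f z - f w| <= L * (`|z.1 - w.1| + `|z.2 - w.2|).

Lemma box_lipschitz_fst : box_lipschitz fst.
Proof. by move=> M; exists 1 => // z w _ _ _ _; rewrite mul1r lerDl. Qed.

Lemma box_lipschitz_snd : box_lipschitz snd.
Proof. by move=> M; exists 1 => // z w _ _ _ _; rewrite mul1r lerDr. Qed.

Lemma box_lipschitz_cst c : box_lipschitz (fun=> c).
Proof. by move=> M; exists 0 => // z w _ _ _ _; rewrite subrr normr0 mul0r. Qed.

Lemma box_lipschitz_add f g : box_lipschitz f -> box_lipschitz g ->
  box_lipschitz (fun z => f z + g z).
Proof.
move=> hf hg M; have [K K0 fK] := hf M; have [L L0 gL] := hg M.
exists (K + L); first exact: addr_ge0.
move=> z w z1 z2 w1 w2; rewrite opprD addrACA mulrDl.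
by apply: le_trans (ler_normD _ _) _; apply: lerD; [exact: fK|exact: gL].
Qed.

Lemma box_lipschitz_bounded f : box_lipschitz f -> forall M : R,
  exists2 B, 0 <= B & forall z : R * R, `|z.1| <= M -> `|z.2| <= M -> `|f z| <= B.
Proof.
move=> hf M; have [L L0 fL] := hf M.
(* The absolute value of [M] keeps the bound nonnegative for [M < 0], when the box is empty. *)
exists (`|f (0, 0)| + L * (`|M| + `|M|)); first by rewrite addr_ge0 ?mulr_ge0 ?addr_ge0.
move=> z z1 z2; have M0 : 0 <= M by apply: le_trans z1.
have := fL z (0, 0) z1 z2; rewrite /= normr0 !subr0 => /(_ M0 M0) h.
rewrite -[f z](subrK (f (0, 0))) addrC.
apply: le_trans (ler_normD _ _) _; rewrite lerD2l; apply: le_trans h _.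
by rewrite ler_wpM2l // lerD // (ger0_norm M0).
Qed.

Lemma box_lipschitz_mul f g : box_lipschitz f -> box_lipschitz g ->
  box_lipschitz (fun z => f z * g z).
Proof.
move=> hf hg M; have [K K0 fK] := hf M; have [L L0 gL] := hg M.
have [A A0 fA] := box_lipschitz_bounded hf M.
have [B B0 gB] := box_lipschitz_bounded hg M.
exists (A * L + B * K); first by rewrite addr_ge0 ?mulr_ge0.
move=> z w z1 z2 w1 w2.
have -> : f z * g z - f w * g w = f z * (g z - g w) + g w * (f z - f w) by ring.
apply: le_trans (ler_normD _ _) _; rewrite mulrDl !normrM -!mulrA.
by apply: lerD; apply: ler_pM; rewrite ?normr_ge0 ?fA ?gB ?fK ?gL.
Qed.

Lemma box_lipschitz_exp f n : box_lipschitz f -> box_lipschitz (fun z => f z ^+ n).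
Proof.
move=> hf; elim: n => [|n IH].
  have -> : (fun z => f z ^+ 0) = fun=> 1 by apply/funext => z; rewrite expr0.
  exact: box_lipschitz_cst.
have -> : (fun z => f z ^+ n.+1) = fun z => f z * f z ^+ n.
  by apply/funext => z; rewrite exprS.
exact: box_lipschitz_mul.
Qed.

(** Between [t0] and [t] both solutions stay in a common box, where the squared distance [D] obeys a
    Gronwall inequality. *)
Lemma solution_unique (F : R * R -> R * R) (g h : R -> R * R) t0 :
  box_lipschitz (fun z => (F z).1) -> box_lipschitz (fun z => (F z).2) ->
  is_solution F g -> is_solution F h -> g t0 = h t0 -> g = h.
Proof.
move=> F1 F2 gs hs gh0; apply/funext => t.
pose a := Num.min t0 t; pose b := Num.max t0 t.
have a_t : a <= t <= b by rewrite /a /b ge_min le_max lexx !orbT.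
have a_t0 : a <= t0 <= b by rewrite /a /b ge_min le_max lexx.
have ab : a <= b by case/andP: a_t; exact: le_trans.
have bnd (f df : R -> R) : (forall t : R, is_derive t 1 f (df t)) ->
    exists M : R, forall s : R, a <= s <= b -> `|f s| <= M.
  move=> dfE; have [|c _ hc] := @EVT_max R (fun s => `|f s|) a b ab.
    apply: continuous_subspaceT => s.
    exact: (continuous_comp (is_derive_continuous (dfE s)) (@norm_continuous _ R _)).
  by exists `|f c| => s sab; apply: hc; rewrite in_itv.
have [M1 hM1] := bnd _ _ (fun t => (gs t).1).
have [M2 hM2] := bnd _ _ (fun t => (gs t).2).
have [M3 hM3] := bnd _ _ (fun t => (hs t).1).
have [M4 hM4] := bnd _ _ (fun t => (hs t).2).
pose M := Num.max (Num.max M1 M2) (Num.max M3 M4).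
have [K K0 hK] := F1 M; have [L L0 hL] := F2 M.
pose D (s : R) := ((g s).1 - (h s).1) ^+ 2 + ((g s).2 - (h s).2) ^+ 2.
have dD (s : R) := isd_add
  (isd_exp 2 (isd_sub (gs s).1 (hs s).1)) (isd_exp 2 (isd_sub (gs s).2 (hs s).2)).
suff Dt : D t = 0.
  have : D t == 0 by rewrite Dt.
  rewrite /D paddr_eq0 ?sqr_ge0 // !sqrf_eq0 !subr_eq0 => /andP[/eqP e1 /eqP e2].
  by rewrite [g t]surjective_pairing e1 e2 -surjective_pairing.
(* Each component contributes twice a product such as x K (x + y), which is at most 2 K (x^2 + y^2);
   hence the factor 4. *)
apply: (@gronwall_zero D _ a b t0 (4 * (K + L)) dD) => //.
- by move=> s; rewrite addr_ge0 // sqr_ge0.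
- move=> s sab; rewrite /= /D !expr1.
  have m1 : `|(g s).1| <= M by rewrite !le_max hM1.
  have m2 : `|(g s).2| <= M by rewrite !le_max hM2 ?orbT.
  have m3 : `|(h s).1| <= M by rewrite !le_max hM3 ?orbT.
  have m4 : `|(h s).2| <= M by rewrite !le_max hM4 ?orbT.
  have := hK _ _ m1 m2 m3 m4; have := hL _ _ m1 m2 m3 m4.
  set p := (g s).1 - (h s).1; set q := (g s).2 - (h s).2.
  set P := (F (g s)).1 - _; set Q := (F (g s)).2 - _ => hQ hP.
  apply: le_trans (ler_normD _ _) _; rewrite !normrM ger0_norm //.
  rewrite -(real_normK (num_real p)) -(real_normK (num_real q)).
  have p0 := normr_ge0 p; have q0 := normr_ge0 q.
  have {}hP := ler_wpM2l p0 hP; have {}hQ := ler_wpM2l q0 hQ.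
  move: p0 q0 hP hQ; set x := `|p|; set y := `|q| => x0 y0 hP hQ.
  have h1 : x * (K * (x + y)) <= 2 * K * (x ^+ 2 + y ^+ 2).
    have : 0 <= K * (x - y) ^+ 2 by rewrite mulr_ge0 // sqr_ge0.
    have : 0 <= K * (x ^+ 2 + y ^+ 2) by rewrite mulr_ge0 // addr_ge0 // sqr_ge0.
    have : 0 <= K * y ^+ 2 by rewrite mulr_ge0 // sqr_ge0.
    nra.
  have h2 : y * (L * (x + y)) <= 2 * L * (x ^+ 2 + y ^+ 2).
    have : 0 <= L * (x - y) ^+ 2 by rewrite mulr_ge0 // sqr_ge0.
    have : 0 <= L * (x ^+ 2 + y ^+ 2) by rewrite mulr_ge0 // addr_ge0 // sqr_ge0.
    have : 0 <= L * x ^+ 2 by rewrite mulr_ge0 // sqr_ge0.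
    nra.
  lra.
- by rewrite /D gh0 !subrr expr0n /= addr0.
Qed.

Lemma system_box_lipschitz m :
  box_lipschitz (fun z : R * R => (system m z).1) /\
  box_lipschitz (fun z : R * R => (system m z).2).
Proof.
have hx := box_lipschitz_fst; have hy := box_lipschitz_snd; split.
  have -> : (fun z : R * R => (system m z).1) = fun z => -1 * z.2.
    by apply/funext => -[x y]; rewrite mulN1r.
  exact: box_lipschitz_mul (box_lipschitz_cst _) hy.
have -> : (fun z : R * R => (system m z).2) = fun z =>
    z.1 + z.1 ^+ (2 * m - 1) * z.2 * (z.1 ^+ 2 + z.2 ^+ 2).
  by apply/funext => -[x y].
exact: (box_lipschitz_add hx (box_lipschitz_mul
  (box_lipschitz_mul (box_lipschitz_exp (2 * m - 1) hx) hy)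
  (box_lipschitz_add (box_lipschitz_exp 2 hx) (box_lipschitz_exp 2 hy)))).
Qed.

End uniqueness.

(** * The center and its common period *)

Section isochronous.
Context {R : realType}.
Variable k : nat.

Lemma orbit_through (q : R * R) :
  0 < enorm q -> enorm q * (16 * (2 * k + 3)%:R + 2) <= 1 ->
  exists g : R -> R * R, [/\ is_solution (system k.+1) g,
    minimal_period g (pi *+ 2), range g q & surrounds (range g) (0, 0)].
Proof.
set r := enorm q; set c := 16 * _ + 2 => r0 rc.
have c1 : 1 <= c by have : 0 <= (2 * k + 3)%:R :> R; [by []|rewrite /c; lra].
have [theta qE] := polar_form q.
(* The initial value r^-n passes the threshold of [radial_solution], because r^n <= r <= 1/c. *)
have cu : c <= r ^- (2 * k + 3).
  have r1 : r <= 1 by nra.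
  have rn : r ^+ (2 * k + 3) <= r by rewrite addn3 exprS ler_piMr ?exprn_ile1 ?(ltW r0).
  rewrite -[c]invrK lef_pV2 ?posrE ?invr_gt0 ?exprn_gt0 //; last by lra.
  by apply: le_trans rn _; rewrite -[c^-1]mul1r ler_pdivlMr //; lra.
have th1 : -1 <= sin theta <= 1 by rewrite sin_geN1 sin_le1.
have [u [u_cont u0 u2 du]] := radial_solution th1 cu.
have [g [gs gp gr]] := orbit_solution u2 du.
exists g; split => //; rewrite gr; last exact: orbit_surrounds.
by exists theta => //; rewrite /orbit_point (orbit_radiusE r0 u0) -qE.
Qed.

Lemma system_isochronous_center : isochronous_center (@system R k.+1) (0, 0).
Proof.
set c : R := 16 * (2 * k + 3)%:R + 2.
have c0 : 0 < c by have : 0 <= (2 * k + 3)%:R :> R; [by []|rewrite /c; lra].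
pose V : set (R * R) := [set z | enorm z * c <= 1].
have F0 : system k.+1 (0, 0) = (0, 0) :> R * R.
  by rewrite /system /= oppr0 mulr0 mul0r addr0.
have V0 : nbhs (0, 0) V.
  have := @continuous_enorm R (0, 0); move/cvgrPdist_lt => /(_ c^-1).
  rewrite invr_gt0 => /(_ c0); apply: filterS => z.
  rewrite enorm0 sub0r normrN ger0_norm ?enorm_ge0 // => h.
  by rewrite /V /= -ler_pdivlMr // mul1r ltW.
have through q : V q -> q <> (0, 0) ->
    exists g : R -> R * R, [/\ is_solution (system k.+1) g,
      minimal_period g (pi *+ 2), range g q & surrounds (range g) (0, 0)].
  move=> Vq q0; apply: orbit_through => //.
  by rewrite lt_neqAle enorm_ge0 andbT eq_sym; apply/eqP => /enorm_eq0.
split.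
  split => //.
  (* The neighborhood is the union of the origin and all surrounding cycles, so that each such cycle
     lies in it by definition; it contains [V]. *)
  exists [set z | z = (0, 0) \/ exists C, [/\ is_cycle (system k.+1) C, C z &
      surrounds C (0, 0)]].
    apply: filterS V0 => q Vq; have [->|q0] := pselect (q = (0, 0)); first by left.
    right; have [g [gs gp gq gS]] := through q Vq q0.
    by exists (range g); split => //; exists (pi *+ 2), g.
  move=> q [Uq q0]; case: Uq => [/q0 //|[C [cC Cq sC]]]; exists C; split => // z Cz; split.
    by right; exists C.
  by move=> z0; case: sC => + _; rewrite -z0.
exists (pi *+ 2), V; split => // C S [g [gs [S0 gS gmin] ->]] [z [[t1 _ gz] Vz]].
have [L1 L2] := @system_box_lipschitz R k.+1.
(* A cycle through the origin would be constant by uniqueness, and then [S / 2] would contradict the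
   minimality of [S]. *)
have z0 : z <> (0, 0).
  move=> z0.
  have zs : is_solution (system k.+1) (fun=> (0, 0) : R * R).
    by move=> t; rewrite F0; split; exact: isd_cst.
  have g0 := solution_unique L1 L2 gs zs (etrans gz z0).
  have [||t] := gmin (S / 2); first by rewrite divr_gt0.
    by rewrite ltr_pdivrMr // mulrDr mulr1 ltrDl.
  by rewrite g0.
have [h [hs [T0 hT hmin] [t2 _ hz] _]] := through z Vz z0.
(* The known orbit through [z], shifted in time to reach [z] together with [g]. *)
pose h' t := h (t + (t2 - t1)).
have hs' : is_solution (system k.+1) h'.
  move=> t; have ds := isd_add (is_derive_id t 1) (isd_cst (t2 - t1) t).
  split; [have := isd_comp (hs _).1 ds|have := isd_comp (hs _).2 ds];
  by rewrite addr0 mulr1.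
have gh : g = h'.
  apply: (solution_unique L1 L2 gs hs' (t0 := t1)).
  by rewrite gz /h' addrC subrK hz.
have hS t : h (t + S) = h t.
  have := gS (t - (t2 - t1)); rewrite gh /h' subrK => <-; congr h; ring.
(* Each of [S] and 2 pi is a period of both solutions, so neither can be smaller than the other. *)
have [lt|lt|//] := ltgtP S (pi *+ 2).
  by have [t []] := hmin S S0 lt.
have [t []] := gmin _ T0 lt.
by rewrite gh /h' addrAC hT.
Qed.

End isochronous.

Theorem theorem3 (R : realType) (m : nat) (hm : (1 <= m)%N) :
  isochronous_center
    (fun z : R * R =>
       let: (x, y) := z in
       (- y, x + x ^+ (2 * m - 1) * y * (x ^+ 2 + y ^+ 2)))
    (0, 0).
Proof. by case: m hm => // k _; exact: system_isochronous_center. Qed.
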